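(* Let $X$ be an $\omega$-narrow Čech-complete topological group and $Y$ be any topological group. Every BP-measurable homomorphism $h:X\to Y$ is continuous.
   Context: A topological group $X$ is $\omega$-narrow if for every nonempty open set $U\subseteq X$ there is a countable set $C\subseteq X$ with $X=CU=UC$. A Tychonoff space is Čech-complete if it is homeomorphic to a $G_\delta$-subset of some compact Hausdorff space. The $\sigma$-algebra of sets with the Baire Property in a space $X$ is the smallest $\sigma$-algebra containing all open and all meager subsets of $X$. A function $f:X\to Y$ is BP-measurable if for every open $U\subseteq Y$ the preimage $f^{-1}[U]$ has the Baire Property in $X$. *)

(* Defs.v *)
From HB Require Import structures.
From mathcomp Require Import all_boot all_order all_algebra.
From mathcomp Require Import all_classical all_reals all_analysis borel_hierarchy.
Set Implicit Arguments. Unset Strict Implicit. Unset Printing Implicit Defensive.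
Local Open Scope classical_set_scope.

Definition is_topological_group (G : topologicalType)
    (mul : G -> G -> G) (inv : G -> G) (e : G) : Prop :=
  [/\ (forall x y z, mul x (mul y z) = mul (mul x y) z),
      (forall x, mul e x = x /\ mul x e = x),
      (forall x, mul (inv x) x = e /\ mul x (inv x) = e),
      continuous (fun p : G * G => mul p.1 p.2) &
      continuous inv].

Definition is_group_hom (X Y : Type) (mulX : X -> X -> X) (mulY : Y -> Y -> Y)
    (h : X -> Y) : Prop :=
  forall x y, h (mulX x y) = mulY (h x) (h y).

Definition omega_narrow (G : topologicalType) (mul : G -> G -> G) : Prop :=
  forall U : set G, open U -> U !=set0 ->
    exists C : set G, countable C /\
      [set mul c u | c in C & u in U] = setT /\
      [set mul u c | u in U & c in C] = setT.

Definition embedding (X K : topologicalType) (f : X -> K) : Prop :=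
  [/\ injective f, continuous f &
      forall U : set X, open U ->
        exists V : set K, open V /\ f @` U = range f `&` V].

Definition cech_complete (X : topologicalType) : Prop :=
  exists (K : topologicalType) (f : X -> K),
    [/\ compact [set: K], hausdorff_space K, embedding f & Gdelta (range f)].

Definition nowhere_dense (T : topologicalType) (A : set T) : Prop :=
  (closure A)° = set0.

Definition meager (T : topologicalType) (A : set T) : Prop :=
  exists F : (set T)^nat, (forall n, nowhere_dense (F n)) /\ A `<=` \bigcup_n F n.

Definition baire_property (T : topologicalType) (A : set T) : Prop :=
  <<s [set B : set T | open B \/ meager B] >> A.

Definition BP_measurable (X Y : topologicalType) (f : X -> Y) : Prop :=
  forall U : set Y, open U -> baire_property (f @^-1` U).

(* Main.v *)
Require Import Defs.
From HB Require Import structures.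
From mathcomp Require Import all_boot all_order all_algebra.
From mathcomp Require Import all_classical all_reals all_analysis.
From mathcomp Require Import wochoice.
From Stdlib Require Import Inverse_Image.

(**
If the preimage [A0] of a neighbourhood [W0] of the unit is nonmeager, Pettis'
argument applies: [A0 A0^-1] is a neighbourhood of the unit because [X] is a
Baire space.  So suppose that [A0] is meager, and let [W W] be contained in
[W0], [A := h^-1(W)].  Every set [T A] has the Baire property, being the
preimage of an open set, while [A A] lies in a countable union of closed
nowhere dense sets [F_j].

Since [X] is omega-narrow and Cech-complete, it has a closed normal subgroup
[N], the intersection of a sequence of neighbourhoods [Q_n] forming a base at
[N], which is so small that the sets [F_j N] are still nowhere dense and so
large that [X/N] is second countable.  A Mycielski-type construction shows that
every comeager subset of a nonempty open set contains a Cantor set of points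
[x] with [x^-1 y] outside all [F_j N].  Modulo [N] there are only continuum
many such Cantor sets, and a translate [z A N] meets each of them in at most
one point.  Hence, as for Bernstein sets, a transfinite recursion selects two
points in each Cantor set such that none of the selected points lies in the
translate [z A N] of another one.  If [T] is the saturation of the first points,
then neither [T A] nor its complement contains any of these Cantor sets, so
that [T A] does not have the Baire property.
*)

Set Implicit Arguments. Unset Strict Implicit. Unset Printing Implicit Defensive.
Local Open Scope classical_set_scope.

(** * Selections along a well-order *)

Lemma well_founded_order (T : Type) : exists lt : T -> T -> Prop,
  well_founded lt /\ forall x y, [\/ lt x y, x = y | lt y x].
Proof.
elim/Peq : T => T; have [R wR] := well_ordering_principle T.
have wR' : wo_chain R predT by move=> A _; exact: wR.
have Ranti x y : R x y -> R y x -> x = y.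
  by move=> xy yx; apply: (wo_chain_antisymmetric wR') => //; rewrite xy.
exists (fun x y => R x y /\ x <> y); split; last first.
  move=> x y; have [->|xy] := pselect (x = y); first by constructor 2.
  have /orP[Rxy|Ryx] : R x y || R y x by exact: (wo_chainW wR').
    by constructor 1.
  by constructor 3; split=> // /esym.
pose lt x y := R x y /\ x <> y; rewrite -/(well_founded lt).
move=> x0; apply: contrapT => nx0.
have [|z [[zA zmin] _]] := wR [pred x | `[< ~ Acc lt x >]].
  by exists x0; apply/asboolP.
have /asboolP zA' := zA; apply: zA'; constructor => y [Ryz yz].
by apply: contrapT => nay; apply/yz/Ranti => //; apply/zmin/asboolP.
Qed.

(** If some initial segment receives an injection [f] of [T], take the least such segment and pull
    the order back along [f]; a new segment receiving [T] would yield a smaller old one. This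
    imitates an initial ordinal. *)
Lemma order_small_segments (T : Type) : exists lt : T -> T -> Prop,
  [/\ well_founded lt, forall x y, [\/ lt x y, x = y | lt y x] &
    forall i (f : T -> T), injective f -> ~ forall x, lt (f x) i].
Proof.
have [lt [wf tri]] := well_founded_order T.
pose big i := exists f : T -> T, injective f /\ forall x, lt (f x) i.
have [[i0 bigi0]|nbig] := pselect (exists i, big i); last first.
  by exists lt; split=> // i f finj fi; apply: nbig; exists i, f.
have [i [[f [finj fi]] imin]] : exists i, big i /\ forall j, lt j i -> ~ big j.
  elim/(well_founded_ind wf): i0 bigi0 => i IH bigi.
  have [[j [ji bigj]]|nj] := pselect (exists j, lt j i /\ big j).
    exact: IH bigj.
  by exists i; split=> // j ji bigj; apply: nj; exists j.
exists (fun x y => lt (f x) (f y)); split.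
- exact: wf_inverse_image.
- move=> x y; case: (tri (f x) (f y)) => [|/finj|] ?.
  + by constructor 1.
  + by constructor 2.
  + by constructor 3.
- move=> j g ginj gj; apply: (imin (f j)) => //.
  by exists (f \o g); split=> //; apply: inj_comp.
Qed.

(** Each earlier point rules out at most one candidate [p i c]. If all candidates were ruled out,
    sending [c] to a culprit would inject [I] into the segment below [i]. *)
Lemma unrelated_selection (I X : Type) (R : X -> X -> Prop) (p : I -> I -> X) :
  (forall x y, R x y -> R y x) ->
  (forall i x c c', R x (p i c) -> R x (p i c') -> c = c') ->
  exists z : I -> I, forall i j, i <> j -> ~ R (p i (z i)) (p j (z j)).
Proof.
move=> Rsym Runiq; have [lt [wf tri small]] := order_small_segments I.
have step i (z : forall j, lt j i -> I) :
    {c | forall j (ji : lt j i), ~ R (p j (z j ji)) (p i c)}.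
  apply: cid; apply: contrapT => /forallNP noc.
  have /choice[f fP] : forall c, exists j, exists ji : lt j i,
      R (p j (z j ji)) (p i c).
    move=> c; apply: contrapT => nj; apply: (noc c) => j ji Rj; apply: nj.
    by exists j, ji.
  apply: (small i f) => [c c' fcc'|c]; last by have [] := fP c.
  have [ji Rc] := fP c; have [ji' Rc'] := fP c'.
  (* The earlier point [z j ji] formally depends on the proof [ji], so the two proofs are identified
     first. *)
  move: ji' Rc'; rewrite -fcc' => ji'; rewrite (Prop_irrelevance ji' ji).
  exact: Runiq.
pose z := Fix wf (fun=> I) (fun i z => sval (step i z)).
have zE i : z i = sval (step i (fun j _ => z j)).
  rewrite /z Fix_eq // => k f g fg; congr (sval (step k _)).
  apply/functional_extensionality_dep => j.
  by apply/functional_extensionality_dep => ji; exact: fg.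
have zlt i j : lt j i -> ~ R (p j (z j)) (p i (z i)).
  by move=> ji; rewrite (zE i); case: (step i _) => c /= /(_ j ji).
exists z => i j ij; case: (tri i j) => // [/zlt //|/zlt + /Rsym//].
Qed.

(** * Baire category in Cech-complete spaces *)

(* A complete sequence of open covers, in the sense of Frolik: [small n U] says
   that [U] refines the [n]th cover. *)
Definition complete_smallness (X : topologicalType) (small : nat -> set X -> Prop) :=
  [/\ forall n (U V : set X), V `<=` U -> small n U -> small n V,
      forall n (x : X), exists2 U, nbhs x U & small n U &
      forall F : set_system X, ProperFilter F ->
        (forall n, exists2 U, F U & small n U) -> exists x, cluster F x].

(** Small of index [n] means that the closure of the image in [K] lies in [W n]. The image of a
    filter with small members clusters in [K] at a point of every [W n], hence of [range f], and the
    embedding carries it back. *)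
Lemma cech_complete_smallness (X : topologicalType) :
  cech_complete X -> exists small : nat -> set X -> Prop, complete_smallness small.
Proof.
move=> [K [f [cK hK [finj fcont fopen] [W Wo Weq]]]].
exists (fun n U => closure (f @` U) `<=` W n); split.
- by move=> n U V VU; apply: subset_trans; exact/closureS/image_subset.
- move=> n x.
  have Wx : nbhs (f x) (W n).
    apply: open_nbhs_nbhs; split; first exact: Wo.
    have : range f (f x) by exists x.
    by rewrite Weq => /(_ n I).
  have [V Vx VW] := compact_regular hK cK filterT Wx.
  exists (f @^-1` V); first exact: fcont.
  by apply: subset_trans VW; apply: closureS => _ [y Vy <-].
- move=> F FF Fsmall.
  have imF U : F U -> (f @ F) (f @` U).
    by move=> FU; rewrite nbhs_simpl /=; apply: filterS FU => y Uy; exists y.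
  have [k [_ kF]] := cK (f @ F) _ filterT.
  have [x _ xk] : range f k.
    rewrite Weq => n _; have [U FU] := Fsmall n; apply.
    by move=> B; apply: kF; exact: imF.
  exists x => A B FA; rewrite nbhsE => -[V [oV Vx] VB].
  have [V' [oV' VV']] := fopen V oV.
  have V'k : nbhs k V'.
    apply: open_nbhs_nbhs; split=> //; rewrite -xk.
    by have [] : (range f `&` V') (f x) by rewrite -VV'; exists x.
  have [_ [[y Ay <-] V'y]] := kF _ _ (imF A FA) V'k.
  have [z Vz zy] : (f @` V) (f y) by rewrite VV'; split => //; exists y.
  by exists y; split=> //; apply: VB; rewrite -(finj _ _ zy).
Qed.

Lemma nowhere_dense_open (X : topologicalType) (F U : set X) :
  nowhere_dense F -> open U -> U !=set0 ->
  exists V, [/\ open V, V !=set0, V `<=` U & V `<=` ~` closure F].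
Proof.
move=> nF oU [x Ux]; exists (U `&` ~` closure F); split=> //.
- by apply: openI => //; apply: closed_openC; exact: closed_closure.
- apply: contrapT => /nonemptyPn UF0.
  have : (closure F)° x.
    rewrite /interior /= nbhsE; exists U => // y Uy; apply: contrapT => nFy.
    by have : (U `&` ~` closure F) y by []; rewrite UF0.
  by rewrite nF.
Qed.

(** * Cantor schemes of open sets *)

Section cantor_scheme.
Variables (X : topologicalType) (small : nat -> set X -> Prop).
Hypothesis smallP : complete_smallness small.
Hypothesis regX : forall (x : X) V, nbhs x V ->
  exists2 U, nbhs x U & closure U `<=` V.
Variables (O : set X) (P : nat -> set X -> Prop) (E : nat -> X -> X -> Prop).
Hypotheses (oO : open O) (O0 : O !=set0).
Hypothesis PS : forall n (U V : set X), V `<=` U -> P n U -> P n V.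
Hypothesis Pdense : forall n U, open U -> U !=set0 ->
  exists V, [/\ open V, V !=set0, V `<=` U & P n V].
Hypothesis Eavoid : forall n U V, open U -> U !=set0 -> open V -> V !=set0 ->
  exists U' V', [/\ open U' /\ U' !=set0, open V' /\ V' !=set0, U' `<=` U, V' `<=` V &
    forall x y, U' x -> V' y -> ~ E n x y].

Let good (S : seq bool -> set X) := forall s, open (S s) /\ S s !=set0.

Let seqs n := [seq tval u | u <- enum {: n.-tuple bool}].

Let mem_seqs s : s \in seqs (size s).
Proof. by apply/mapP; exists (in_tuple s); rewrite ?mem_enum. Qed.

(** Triples are treated one at a time; shrinking the cells [s] and [t] preserves what was achieved
    before. *)
Let avoid_pairs (L : seq (nat * (seq bool * seq bool))) S : good S ->
  exists2 S', good S' & (forall s, S' s `<=` S s) /\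
    forall j s t, (j, (s, t)) \in L -> s <> t ->
      forall x y, S' s x -> S' t y -> ~ E j x y.
Proof.
elim: L S => [|[j [s t]] L IH] S gS.
  by exists S => //; split=> [s //|j s t]; rewrite in_nil.
have [S1 gS1 [S1S S1L]] := IH S gS.
have [st|st] := eqVneq s t.
  exists S1 => //; split=> // j' s' t'; rewrite inE => /orP[/eqP[_ -> -> /(_ st)//]|].
  exact: S1L.
have [U [V [oU oV US VS EUV]]] := Eavoid j (gS1 s).1 (gS1 s).2 (gS1 t).1 (gS1 t).2.
pose S2 u := if u == s then U else if u == t then V else S1 u.
have S21 u : S2 u `<=` S1 u.
  rewrite /S2; case: eqVneq => [->//|_]; case: eqVneq => [->//|_].
  exact: subset_refl.
exists S2; last split.
- by move=> u; rewrite /S2; case: ifP => // _; case: ifP.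
- by move=> u; apply: subset_trans (S1S u).
- move=> j' s' t'; rewrite inE => /orP[/eqP[-> -> ->] _ x y|jL s't' x y xS yS].
    by rewrite /S2 eqxx eq_sym (negbTE st) eqxx; exact: EUV.
  by apply: (S1L _ _ _ jL s't'); exact: S21.
Qed.

(** [take n.-1 s] is the parent of a cell of length [n]; for [n = 0] the parent family will be
    constantly [O]. Separation is asked only at length [n], where there are finitely many pairs. *)
Let step n (S S' : seq bool -> set X) :=
  [/\ forall s, closure (S' s) `<=` S (take n.-1 s),
      forall s, P n (S' s), forall s, small n (S' s) &
      forall j s t, (j <= n)%N -> size s = n -> size t = n -> s <> t ->
        forall x y, S' s x -> S' t y -> ~ E j x y].

Let stepP n S : good S -> exists2 S', good S' & step n S S'.
Proof.
move=> gS; have [smallS small_nbhs _] := smallP.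
have /choice[S1 S1P] : forall s, exists U, [/\ open U /\ U !=set0,
    closure U `<=` S (take n.-1 s), P n U & small n U].
  move=> s; have [oS S0] := gS (take n.-1 s).
  have [V [oV [x Vx] VS PV]] := Pdense n oS S0.
  have [U1 U1x cU1] := regX (open_nbhs_nbhs (conj oV Vx)).
  have [U2 U2x sU2] := small_nbhs n x.
  have [U3 [oU3 U3x] U312] : exists2 U3, open_nbhs x U3 & U3 `<=` U1 `&` U2.
    have : nbhs x (U1 `&` U2) by exact: filterI.
    by rewrite nbhsE.
  exists U3; split.
  - by split=> //; exists x.
  - apply: subset_trans VS; apply: subset_trans cU1.
    by apply: closureS => y /U312[].
  - apply: (PS _ PV) => y /U312[U1y _].
    by apply: cU1; exact: subset_closure.
  - by apply: (smallS _ _ _ _ sU2) => y /U312[_].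
pose L := [seq (j, st) | j <- iota 0 n.+1,
  st <- [seq (s, t) | s <- seqs n, t <- seqs n]].
have gS1 : good S1 by move=> s; have [] := S1P s.
have [S2 gS2 [S21 S2E]] := avoid_pairs L gS1.
exists S2 => //; split.
- move=> s; have [_ + _ _] := S1P s; apply: subset_trans; exact: closureS.
- by move=> s; have [_ _ + _] := S1P s; exact: PS.
- by move=> s; have [_ _ _] := S1P s; exact: smallS.
- move=> j s t jn sn tn st; apply: S2E st.
  apply: allpairs_f; first by rewrite mem_iota.
  by apply: allpairs_f; [rewrite -sn|rewrite -tn]; exact: mem_seqs.
Qed.

(** The nested cells of a branch generate a filter with small members. Its cluster point lies in the
    closure of every cell, hence in every parent. *)
Lemma cantor_scheme : exists S : nat -> seq bool -> set X,
  [/\ forall n s, P n (S n s), forall n s, S n s `<=` O,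
      forall n j s t, (j <= n)%N -> size s = n -> size t = n -> s <> t ->
        forall x y, S n s x -> S n t y -> ~ E j x y &
      forall a : nat -> bool, exists x, forall n, S n (mkseq a n) x].
Proof.
have /choice[g gP] : forall nS : nat * (seq bool -> set X), exists S',
    good nS.2 -> good S' /\ step nS.1 nS.2 S'.
  move=> [n S]; have [gS|ngS] := pselect (good S); last by exists S.
  by have [S' gS' st] := stepP n gS; exists S'.
pose S := fix S n := if n is m.+1 then g (n, S m) else g (0%N, fun=> O).
have gS n : good (S n).
  elim: n => [|n IH] /=; first by have [] := gP (0%N, fun=> O) (fun=> conj oO O0).
  by have [] := gP (n.+1, S n) IH.
have S0 : step 0 (fun=> O) (S 0%N).
  by have [] := gP (0%N, fun=> O) (fun=> conj oO O0).
have SS n : step n.+1 (S n) (S n.+1) by have [] := gP (n.+1, S n) (gS n).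
have stS n : exists S', step n S' (S n).
  by case: n => [|n]; eexists; [exact: S0|exact: SS].
exists S; split.
- by move=> n s; have [? []] := stS n.
- elim=> [|n IH] s.
    have [+ _ _ _] := S0 => /(_ s); apply: subset_trans.
    exact: subset_closure.
  have [+ _ _ _] := SS n => /(_ s) /= cS x Sx.
  by apply: (IH (take n s)); apply: cS; exact: subset_closure.
- by move=> n j s t; have [? []] := stS n => _ _ _; apply.
move=> a; pose T n := S n (mkseq a n).
have TS n : closure (T n.+1) `<=` T n.
  have [/(_ (mkseq a n.+1)) + _ _ _] := SS n.
  by rewrite /= /T /mkseq -map_take take_iota (minn_idPl (leqnSn n)).
have Tdec n m : (n <= m)%N -> T m `<=` T n.
  elim: m => [|m IH]; first by rewrite leqn0 => /eqP->.
  rewrite leq_eqVlt => /orP[/eqP->//|/IH]; apply: subset_trans.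
  by move=> x Tx; apply: TS; exact: subset_closure.
have FF : Filter (filter_from setT T).
  apply: filter_from_filter; first by exists 0%N.
  move=> n m _ _; exists (maxn n m) => // x Tx.
  by split; apply: Tdec Tx; rewrite ?leq_maxl ?leq_maxr.
have PF : ProperFilter (filter_from setT T).
  by apply: filter_from_proper => n _; have [] := gS n (mkseq a n).
have [_ _ /(_ _ PF)[|x xF]] := smallP.
  move=> n; exists (T n); first by exists n.
  by have [? [_ _ + _]] := stS n; apply.
exists x => n; apply: TS => B xB; apply: xF => //.
by exists n.+1.
Qed.

End cantor_scheme.

(** A Cantor scheme with nothing to separate: cells of level [n] miss the closure of [F n], and any
    branch gives the point. *)
Lemma baire (X : topologicalType) (small : nat -> set X -> Prop) (O M : set X) :
  complete_smallness small ->
  (forall (x : X) V, nbhs x V -> exists2 U, nbhs x U & closure U `<=` V) ->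
  open O -> O !=set0 -> meager M -> exists2 x, O x & ~ M x.
Proof.
move=> smallP regX oO O0 [F [nF MF]].
have [|n U oU U0|n U V oU U0 oV V0|S [SP SO _ /(_ (fun=> false))[x xS]]] :=
  @cantor_scheme X small smallP regX O (fun n V => V `<=` ~` closure (F n))
    (fun _ _ _ => False) oO O0.
- by move=> n U V VU; exact: subset_trans.
- exact: nowhere_dense_open.
- by exists U, V; split=> [||x|x|x y _ _ []].
exists x; first by have /SO := xS 0%N.
move=> /MF[n _ Fx]; have /(_ _ (xS n)) := SP n (mkseq (fun=> false) n).
by apply; exact: subset_closure.
Qed.

(** * Meager sets and the Baire property *)

Lemma meagerS (X : topologicalType) (A B : set X) : A `<=` B -> meager B -> meager A.
Proof. by move=> AB [F [nF BF]]; exists F; split=> //; exact: subset_trans BF. Qed.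

Lemma nowhere_dense0 (X : topologicalType) : nowhere_dense (@set0 X).
Proof. by rewrite /nowhere_dense closure0 interior0. Qed.

Lemma meager_bigcup (X : topologicalType) (M : (set X)^nat) :
  (forall n, meager (M n)) -> meager (\bigcup_n M n).
Proof.
move=> /choice[F FP].
exists (fun k => if unpickle k is Some (n, m) then F n m else set0); split.
  move=> k; case: unpickle => [[n m]|]; last exact: nowhere_dense0.
  by have [] := FP n.
move=> x [n _]; have [_ MF] := FP n; move=> /MF[m _ Fx].
by exists (pickle (n, m)) => //; rewrite pickleK.
Qed.

Lemma meagerU (X : topologicalType) (A B : set X) :
  meager A -> meager B -> meager (A `|` B).
Proof.
move=> mA mB; apply: (@meagerS _ _ (\bigcup_n (if n is 0%N then A else B))).
  by move=> x [Ax|Bx]; [exists 0%N|exists 1%N].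
by apply: meager_bigcup => -[].
Qed.

Lemma nowhere_dense_boundary (X : topologicalType) (U : set X) :
  open U -> nowhere_dense (closure U `\` U).
Proof.
move=> oU; rewrite /nowhere_dense; have /closure_id <- : closed (closure U `\` U).
  by rewrite setDE; apply: closedI; [exact: closed_closure|exact: open_closedC].
rewrite -subset0 => x bx; have [Ux _] := nbhs_singleton bx.
by have [y [Uy [_]]] := Ux _ bx.
Qed.

(** The sets that are open modulo meager form a sigma-algebra. For complements, [O] gives way to the
    complement of its closure, at the cost of a nowhere dense boundary. *)
Lemma baire_property_open (X : topologicalType) (A : set X) :
  baire_property A ->
  exists2 O, open O & meager (A `\` O `|` O `\` A).
Proof.
have meager0 : meager (@set0 X).
  by exists (fun=> set0); split=> // _; exact: nowhere_dense0.
move=> bA; apply: (bA [set B | exists2 O, open O & meager (B `\` O `|` O `\` B)]).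
split; last first.
  move=> B [oB|mB]; first by exists B; rewrite // setDv setU0.
  by exists set0; [exact: open0|rewrite setD0 set0D setU0].
split.
- by exists set0; [exact: open0|rewrite setDv setU0].
- move=> B [ O oO mBO]; rewrite setTD; exists (~` closure O).
    by apply: closed_openC; exact: closed_closure.
  have mb : meager (closure O `\` O).
    exists (fun=> closure O `\` O); split=> [_|x]; last by exists 0%N.
    exact: nowhere_dense_boundary.
  apply: meagerS (meagerU mBO mb) => x [[nBx /contrapT cOx]|[ncOx /contrapT Bx]].
    by have [Ox|nOx] := pselect (O x); [left; right|right].
  by left; left; split=> // /subset_closure.
- move=> B BO; have /choice[ O OP] : forall n, exists O,
      open O /\ meager (B n `\` O `|` O `\` B n).
    by move=> n; have [ O] := BO n; exists O.
  have oO n : open (O n) by have [] := OP n.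
  have mO n : meager (B n `\` O n `|` O n `\` B n) by have [] := OP n.
  exists (\bigcup_n O n); first exact: bigcup_open.
  apply: meagerS (meager_bigcup mO) => x [[[n _ Bx] nO]|[[n _ Ox] nB]].
    by exists n => //; left; split=> // Ox; apply: nO; exists n.
  by exists n => //; right; split=> // Bx; apply: nB; exists n.
Qed.

(** Dependent choice on the whole past: since [P n] reads only terms below [n], a finite list padded
    by [t0] can replace the sequence. *)
Lemma history_choice (T : Type) (t0 : T) (P : nat -> (nat -> T) -> T -> Prop) :
  (forall n R R' t, (forall i, (i < n)%N -> R i = R' i) -> P n R t -> P n R' t) ->
  (forall n R, exists t, P n R t) ->
  exists Q : nat -> T, forall n, P n Q (Q n).
Proof.
move=> Pext Pex; have [f fP] := choice (fun nR => Pex nR.1 nR.2).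
pose hist := fix hist n :=
  if n is m.+1 then rcons (hist m) (f (m, nth t0 (hist m))) else [::].
pose Q n := f (n, nth t0 (hist n)).
have size_hist n : size (hist n) = n by elim: n => //= n IH; rewrite size_rcons IH.
exists Q => n; apply: Pext (fP (n, nth t0 (hist n))) => /= i.
elim: n => // n IH; rewrite ltnS leq_eqVlt nth_rcons size_hist.
by move=> /orP[/eqP->|lin]; [rewrite ltnn eqxx|rewrite lin; exact: IH].
Qed.


(** * Topological groups *)

Section topological_group.
Variables (X : topologicalType) (mul : X -> X -> X) (inv : X -> X) (e : X).
Hypothesis grp : is_topological_group mul inv e.
Local Notation "x *g y" := (mul x y) (at level 40, left associativity).
Local Notation "x ^-g" := (inv x) (at level 3, format "x ^-g").

Let mulA x y z : (x *g y) *g z = x *g (y *g z).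
Proof. by have [-> _ _ _ _] := grp. Qed.
Let mul1 x : e *g x = x. Proof. by have [_ /(_ x)[-> _] _ _ _] := grp. Qed.
Let mulr1 x : x *g e = x. Proof. by have [_ /(_ x)[_ ->] _ _ _] := grp. Qed.
Let mulV x : x^-g *g x = e. Proof. by have [_ _ /(_ x)[-> _] _ _] := grp. Qed.
Let mulrV x : x *g x^-g = e. Proof. by have [_ _ /(_ x)[_ ->] _ _] := grp. Qed.
Let mulK x y : x^-g *g (x *g y) = y. Proof. by rewrite -mulA mulV mul1. Qed.
Let mulKV x y : x *g (x^-g *g y) = y. Proof. by rewrite -mulA mulrV mul1. Qed.
Let invK x : x^-g^-g = x.
Proof. by rewrite -[LHS]mulr1 -(mulV x) mulK. Qed.
Let inv1 : e^-g = e. Proof. by rewrite -[LHS]mulr1 mulV. Qed.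
Let invM x y : (x *g y)^-g = y^-g *g x^-g.
Proof. by rewrite -[RHS](mulK (x *g y)) mulA mulKV mulrV mulr1. Qed.

(* A confluent system: [rewrite !gE] decides equality of words in a free group. *)
Let gE := (invM, mulA, mulK, mulKV, mulV, mulrV, invK, inv1, mul1, mulr1).

Let mul_cont x y V : nbhs (x *g y) V ->
  exists U W, [/\ open U, U x, open W, W y & forall u w, U u -> W w -> V (u *g w)].
Proof.
have [_ _ _ cmul _] := grp => /(cmul (x, y)) [[U W] [Ux Wy] UWV].
move: Ux Wy; rewrite /= !nbhsE => -[U' [oU' U'x] U'U] [W' [oW' W'y] W'W].
exists U', W'; split=> // u w Uu Ww; apply: (UWV (u, w)).
by split; [exact: U'U|exact: W'W].
Qed.

Lemma nbhs_lmul a x V : nbhs (a *g x) V -> nbhs x [set y | V (a *g y)].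
Proof.
move=> /mul_cont[U [W [_ Ua oW Wx UWV]]].
by rewrite nbhsE; exists W => // w Ww; exact: UWV.
Qed.

Let nbhs_rmul a x V : nbhs (x *g a) V -> nbhs x [set y | V (y *g a)].
Proof.
move=> /mul_cont[U [W [oU Ux _ Wa UWV]]].
by rewrite nbhsE; exists U => // w Ww; exact: UWV.
Qed.

Lemma open_lmul a V : open V -> open [set y | V (a *g y)].
Proof.
by rewrite !openE => oV x /= Vx; apply: nbhs_lmul; exact: oV.
Qed.

Let open_rmul a V : open V -> open [set y | V (y *g a)].
Proof.
by rewrite !openE => oV x /= Vx; apply: nbhs_rmul; exact: oV.
Qed.

Lemma symmetric_nbhs V : nbhs e V -> exists U, [/\ open U, U e,
  forall x, U x -> U x^-g & forall x y, U x -> U y -> V (x *g y)].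
Proof.
rewrite -{1}(mul1 e) => /mul_cont[U [W [oU Ue oW We UWV]]].
have [_ _ _ _ cinv] := grp.
pose S := U `&` W; have oS : open S by exact: openI.
exists (S `&` inv @^-1` S); split.
- by apply: openI => //; apply: open_comp => // x _; exact: cinv.
- by split; rewrite /preimage /= ?inv1.
- by move=> x [Sx Sx']; split; rewrite /preimage /= ?invK.
- by move=> x y [[Ux _] _] [[_ Wy] _]; exact: UWV.
Qed.

Lemma group_regular (x : X) V : nbhs x V -> exists2 U, nbhs x U & closure U `<=` V.
Proof.
rewrite -{1}(mulr1 x) => /nbhs_lmul/symmetric_nbhs[U [oU Ue Uinv UV]].
exists [set y | U (x^-g *g y)].
  by apply: nbhs_lmul; apply: open_nbhs_nbhs; rewrite mulV.
move=> z cz; have [|y [/= Uxy Uzy]] := cz [set y | U (z^-g *g y)].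
  by apply: nbhs_lmul; apply: open_nbhs_nbhs; rewrite mulV.
by have := UV _ _ Uxy (Uinv _ Uzy); rewrite /= !gE.
Qed.

(** * Small normal subgroups from omega-narrowness *)

Lemma omega_narrow_cover U : omega_narrow mul -> open U -> U e ->
  exists c : nat -> X, forall x,
    (exists k, U ((c k)^-g *g x)) /\ (exists k, U (x *g (c k)^-g)).
Proof.
move=> narrow oU Ue; have [|C [/countable_injP[f finj] [CU UC]]] := narrow U oU.
  by exists e.
exists (fun k => xget e [set x | C x /\ f x = k]) => x.
have cE a : C a -> xget e [set x | C x /\ f x = f a] = a.
  move=> Ca; case: xgetP => [b _ [Cb fba]|/(_ a)[]//].
  by apply: finj fba; exact: mem_set.
split.
- have : [set mul c u | c in C & u in U] x by rewrite CU.
  by move=> [a Ca [u Uu <-]]; exists (f a); rewrite (cE _ Ca) !gE.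
- have : [set mul u c | u in U & c in C] x by rewrite UC.
  by move=> [u Uu [a Ca <-]]; exists (f a); rewrite (cE _ Ca) !gE.
Qed.

Let finite_nbhs n (V : nat -> set X) : (forall i, (i < n)%N -> nbhs e (V i)) ->
  nbhs e [set x | forall i, (i < n)%N -> V i x].
Proof.
elim: n => [|n IH] Vn; first by apply: filterS filterT.
apply: filterS (filterI (IH (fun i ltin => Vn i (ltnW ltin))) (Vn n (ltnSn n))).
move=> x [Vx Vnx] i; rewrite ltnS leq_eqVlt => /orP[/eqP->//|].
exact: Vx.
Qed.

(* The last three clauses make the intersection [N] of the [Q n] such that [X/N]
   is second countable, [N] is normal, and the sets [F j *g N] are nowhere dense. *)
Definition separating_sequence (small : nat -> set X -> Prop) (F : nat -> set X)
    (Q : nat -> set X) (c : nat -> nat -> X) : Prop :=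
  [/\ forall n, [/\ open (Q n), Q n e & forall x, Q n x -> Q n x^-g],
      forall n m x y, (n < m)%N -> Q m x -> Q m y -> Q n (x *g y),
      forall n, small n (Q n) &
  [/\ forall n x, (exists k, Q n ((c n k)^-g *g x)) /\ exists k, Q n (x *g (c n k)^-g),
      forall n k, exists m, forall q, Q m q -> Q n (c n k *g q *g (c n k)^-g) &
      forall n k j, exists m p, Q n ((c n k)^-g *g p) /\
        forall q, Q m q -> ~ closure (F j) (p *g q)]].

(** [Q n] is chosen by recursion to meet the finitely many requirements with indices below [n], each
    of which holds on a neighbourhood of [e]; every requirement is thus met eventually. *)
Lemma separating_sequence_exists small F :
  omega_narrow mul -> complete_smallness small -> (forall j, nowhere_dense (F j)) ->
  exists Q c, separating_sequence small F Q c.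
Proof.
move=> narrow [smallS small_nbhs _] nF.
(* [c] and [p] are fixed for all sets [U] beforehand, so that the requirements at each stage are
   determined by the earlier [Q i]. *)
have /choice[c cP] : forall U : set X, exists c : nat -> X, open U -> U e ->
    forall x, (exists k, U ((c k)^-g *g x)) /\ (exists k, U (x *g (c k)^-g)).
  move=> U; have [[oU Ue]|nU] := pselect (open U /\ U e); last first.
    by exists (fun=> e) => oU Ue; case: nU.
  by have [c cU] := omega_narrow_cover narrow oU Ue; exists c.
have /choice[p pP] : forall Ukj : set X * (nat * nat), exists p,
    open Ukj.1 -> Ukj.1 e ->
    Ukj.1 ((c Ukj.1 Ukj.2.1)^-g *g p) /\ ~ closure (F Ukj.2.2) p.
  move=> [U [k j]] /=; have [[oU Ue]|nU] := pselect (open U /\ U e); last first.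
    by exists e => oU Ue; case: nU.
  have [|||V [_ [x Vx] VU VF]] :=
    @nowhere_dense_open X (F j) [set x | U ((c U k)^-g *g x)].
  - exact: nF.
  - exact: open_lmul.
  - by exists (c U k); rewrite /= mulV.
  by exists x => _ _; split; [exact: VU|exact: VF].
pose good (U : set X) := [/\ open U, U e & forall x, U x -> U x^-g].
(* The guard makes [P] satisfiable after any history, as [history_choice] demands; strong induction
   discharges it later. *)
pose P n (R : nat -> set X) (U : set X) := (forall i, (i < n)%N -> good (R i)) ->
  [/\ good U, small n U,
    forall i x y, (i < n)%N -> U x -> U y -> R i (x *g y) &
    forall i k j q, (i < n)%N -> (k < n)%N -> (j < n)%N -> U q ->
      R i (c (R i) k *g q *g (c (R i) k)^-g) /\
      ~ closure (F j) (p (R i, (k, j)) *g q)].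
have [||Q QP] := @history_choice (set X) setT P.
- move=> n R R' U RR' PR gR'.
  have [i ltin|gU sU UR UF] := PR; first by rewrite RR' //; exact: gR'.
  split=> // [i x y ltin|i k j q ltin ltkn ltjn].
    by rewrite -RR' //; exact: UR.
  by rewrite -RR' //; exact: UF.
- move=> n R; have [gR|ngR] := pselect (forall i, (i < n)%N -> good (R i));
    last by exists setT.
  have [W We sW] := small_nbhs n e.
  have VR : nbhs e [set x | forall i, (i < n)%N -> R i x].
    by apply: finite_nbhs => i /gR[oR Re _]; exact: open_nbhs_nbhs.
  have VF : nbhs e [set q | forall i, (i < n)%N -> forall k, (k < n)%N ->
      forall j, (j < n)%N -> R i (c (R i) k *g q *g (c (R i) k)^-g) /\
        ~ closure (F j) (p (R i, (k, j)) *g q)].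
    apply: finite_nbhs => i /gR[oR Re _]; apply: finite_nbhs => k _.
    apply: finite_nbhs => j _; apply: filterI.
      apply: (@nbhs_lmul (c (R i) k) e [set y | R i (y *g (c (R i) k)^-g)]).
      by apply: nbhs_rmul; rewrite mulr1 mulrV; exact: open_nbhs_nbhs.
    apply: (@nbhs_lmul _ e (~` closure (F j))); rewrite mulr1.
    apply: open_nbhs_nbhs; split; first exact/closed_openC/closed_closure.
    by have [] := pP (R i, (k, j)) oR Re.
  have [U [oU Ue Uinv UV]] := symmetric_nbhs (filterI We (filterI VR VF)).
  have UV1 x : U x -> _ := fun Ux => UV x e Ux Ue.
  exists U => _; split=> //.
  + by apply: (smallS _ _ _ _ sW) => x /UV1[+ _]; rewrite mulr1.
  + by move=> i x y ltin Ux Uy; have [_ [+ _]] := UV x y Ux Uy; apply.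
  + by move=> i k j q ltin ltkn ltjn /UV1[_ [_ +]]; rewrite mulr1; apply.
have gQ n : good (Q n).
  by elim/ltn_ind: n => n IH; have [] := QP n IH.
have {}QP n := QP n (fun i _ => gQ i).
exists Q, (fun n => c (Q n)); split=> //.
- by move=> n m x y nm; have [_ _ + _] := QP m; apply.
- by move=> n; have [] := QP n.
split.
- by move=> n x; have [oQ Qe _] := gQ n; exact: cP.
- move=> n k; exists (maxn n k).+1 => q Qq.
  have [_ _ _ /(_ n k 0%N q)[]//] := QP (maxn n k).+1.
  + by rewrite ltnS leq_maxl.
  + by rewrite ltnS leq_maxr.
- move=> n k j; exists (maxn n (maxn k j)).+1, (p (Q n, (k, j))); split.
    by have [oQ Qe _] := gQ n; have [] := pP (Q n, (k, j)) oQ Qe.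
  move=> q Qq; have [_ _ _ /(_ n k j q)[]//] := QP (maxn n (maxn k j)).+1.
  + by rewrite ltnS leq_maxl.
  + by rewrite ltnS leq_max leq_maxl orbT.
  + by rewrite ltnS !leq_max leqnn !orbT.
Qed.

(** * Cantor sets modulo the normal subgroup *)

Section perfect_codes.
Variables (small : nat -> set X -> Prop) (F : nat -> set X).
Variables (Q : nat -> set X) (c : nat -> nat -> X).
Hypothesis smallP : complete_smallness small.
Hypothesis sepQ : separating_sequence small F Q c.

Let N : set X := [set x | forall n, Q n x].

Let oQ n : open (Q n). Proof. by have [/(_ n)[]] := sepQ. Qed.
Let Q1 n : Q n e. Proof. by have [/(_ n)[]] := sepQ. Qed.
Let QV n x : Q n x -> Q n x^-g.
Proof. by have [/(_ n)[_ _ +] _ _ _] := sepQ; apply. Qed.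
Let QM n x y : Q n.+1 x -> Q n.+1 y -> Q n (x *g y).
Proof. by have [_ + _ _] := sepQ; apply. Qed.
Let Q_decr n x : Q n.+1 x -> Q n x.
Proof. by move=> Qx; rewrite -(mulr1 x); exact: QM. Qed.
Let cQl n x : exists k, Q n ((c n k)^-g *g x).
Proof. by have [_ _ _ [/(_ n x)[]]] := sepQ. Qed.

Let N1 : N e. Proof. by move=> n. Qed.
Let NV x : N x -> N x^-g. Proof. by move=> Nx n; exact: QV. Qed.
Let NM x y : N x -> N y -> N (x *g y).
Proof. by move=> Nx Ny n; exact: QM. Qed.
(** Only conjugation by the [c n k] is controlled. Some [c n.+2 k] agrees with [x] up to a left
    factor in [Q n.+2], and the two further products cost two levels. *)
Let NJ x u : N u -> N (x *g u *g x^-g).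
Proof.
move=> Nu n; have [_ _ _ [/(_ n.+2 x)[_ [k Qxc]] Qc _]] := sepQ.
have [m /(_ u (Nu m)) Qcuc] := Qc n.+2 k.
have := QM (QM Qxc Qcuc) (QV (Q_decr Qxc)).
by rewrite !gE.
Qed.

(* Smallness of the [Q n] replaces compactness of [N]. *)
Let N_base U : open U -> N `<=` U -> exists n, Q n `<=` U.
Proof.
move=> oU NU; apply: contrapT => nQU.
have Q_mono n m x : (n <= m)%N -> Q m x -> Q n x.
  elim: m => [|m IH]; first by rewrite leqn0 => /eqP->.
  by rewrite leq_eqVlt => /orP[/eqP->//|/IH nm /Q_decr /nm].
have FF : Filter (filter_from setT (fun n => Q n `\` U)).
  apply: filter_from_filter; first by exists 0%N.
  move=> n m _ _; exists (maxn n m) => // x [Qx nUx].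
  by split; split=> //; apply: Q_mono Qx; rewrite ?leq_maxl ?leq_maxr.
have PF : ProperFilter (filter_from setT (fun n => Q n `\` U)).
  apply: filter_from_proper => n _; apply: contrapT => QU0; apply: nQU.
  by exists n => x Qx; apply: contrapT => nUx; apply: QU0; exists x.
have [smallS _ /(_ _ PF)[n|x xF]] := smallP.
  exists (Q n `\` U); first by exists n.
  by have [_ _ /(_ n) sQ _] := sepQ; apply: (smallS _ _ _ _ sQ) => x [].
have Nx : N x.
  move=> n; have [||w [[Qw _] /= Qwx]] :=
    xF (Q n.+1 `\` U) [set w | Q n.+1 (x^-g *g w)].
  - by exists n.+1.
  - by apply: nbhs_lmul; rewrite mulV; exact: open_nbhs_nbhs.
  by have := QM Qw (QV Qwx); rewrite !gE.
have [||w [[_ nUw] Uw]] := xF (Q 0%N `\` U) U; last by [].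
- by exists 0%N.
- by apply: open_nbhs_nbhs; split=> //; exact: NU.
Qed.

(** With [x] in [O], the open set [x^-g O N] contains [N], hence some [Q n]. So a point [p] near [x]
    with [p Q m] off the closure of [F j] has a translate [p u] in [O], [u] in [N], and [V] is taken
    around [p u]. *)
Let saturation_avoid j O : open O -> O !=set0 ->
  exists V, [/\ open V, V !=set0, V `<=` O &
    forall x u, V x -> N u -> ~ closure (F j) (x *g u)].
Proof.
move=> oO [x Ox].
pose R := [set r | O (x *g r)].
have oRN : open [set w | exists2 u, N u & R (w *g u)].
  have -> : [set w | exists2 u, N u & R (w *g u)] =
      \bigcup_(u in N) [set w | R (w *g u)].
    by apply/seteqP; split=> w [u Nu Ru]; exists u.
  by apply: bigcup_open => u _; apply: open_rmul; exact: open_lmul.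
have [|n QRN] := N_base oRN.
  by move=> w Nw; exists w^-g; [exact: NV|rewrite /R /= !gE].
have [k Qx] := cQl n.+1 x.
have [_ _ _ [_ _ /(_ n.+1 k j)[m [p [Qp pF]]]]] := sepQ.
have [|u Nu] := QRN (x^-g *g p).
  by have := QM (QV Qx) Qp; rewrite !gE.
rewrite /R /= !gE => Opu.
exists (O `&` [set y | Q m.+1 (p^-g *g (y *g u^-g))]); split.
- apply: openI => //.
  exact: (@open_rmul u^-g [set y | Q m.+1 (p^-g *g y)] (open_lmul _ _)).
- by exists (p *g u); split=> //=; rewrite !gE.
- by move=> y [].
- move=> y v [_ /= Qy] Nv.
  have /pF : Q m (p^-g *g (y *g u^-g) *g (u *g v)) by apply: QM => //; exact: NM.
  by rewrite !gE.
Qed.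

(* A code [g] stands for the Cantor scheme of the sets
   [c n (g s) *g Q n], [n = size s]; there are only continuum many codes, and the
   points in a given branch form at most one coset of [N]. *)
Definition in_branch (g : seq bool -> nat) (a : nat -> bool) : set X :=
  [set x | forall n, Q n ((c n (g (mkseq a n)))^-g *g x)].

Let in_branch_coset g a x y : in_branch g a x -> in_branch g a y -> N (x^-g *g y).
Proof.
by move=> gx gy n; have := QM (QV (gx n.+1)) (gy n.+1); rewrite !gE.
Qed.

Definition perfect_code (g : seq bool -> nat) : Prop :=
  (forall a, in_branch g a !=set0) /\
  forall a b x y u j, a <> b -> in_branch g a x -> in_branch g b y -> N u ->
    ~ closure (F j) (x^-g *g y *g u).

(** In the Cantor scheme each cell of level [n] is put inside one translate of [Q n], whose index is
    the code. A branch of the code then agrees modulo [N] with the point of the scheme. *)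
Let perfect_code_exists O M : open O -> O !=set0 -> meager M ->
  exists2 g, perfect_code g &
    forall a x, in_branch g a x -> exists2 y, N (y^-g *g x) & O y /\ ~ M y.
Proof.
move=> oO O0 [K [nK MK]].
pose P n (V : set X) := V `<=` ~` closure (K n) /\
  exists k, forall x, V x -> Q n ((c n k)^-g *g x).
pose E j x y := exists2 u, N u & closure (F j) (x^-g *g y *g u).
have [n U V VU [UK [k Uk]]|n U oU U0|j U V oU [x Ux] oV [y Vy]|S [SP SO SE Sa]] :=
  @cantor_scheme X small smallP group_regular O P E oO O0.
- split; first exact: subset_trans UK.
  by exists k => x Vx; apply: Uk; exact: VU.
- have [V [oV [x Vx] VU VK]] := nowhere_dense_open (nK n) oU U0.
  have [k Qx] := cQl n x.
  exists (V `&` [set y | Q n ((c n k)^-g *g y)]); split.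
  + by apply: openI => //; exact: open_lmul.
  + by exists x.
  + by move=> y [Vy _]; exact: VU.
  + by split=> [y [Vy _]|]; [exact: VK|exists k => y []].
(* [x] stays and [y] moves to [x *g w], so that the quotient is [w]; continuity of [x'^-g *g y']
   keeps nearby quotients in [W]. *)
- have [||W [oW [w Ww] WV WF]] := @saturation_avoid j [set w | V (x *g w)].
  + exact: open_lmul.
  + by exists (x^-g *g y); rewrite /= !gE.
  have /mul_cont[U' [V' [oU' U'x oV' V'w UV']]] : nbhs (x^-g *g (x *g w)) W.
    by rewrite mulK; exact: open_nbhs_nbhs.
  have oU1 : open [set z | U' z^-g].
    by have [_ _ _ _ cinv] := grp; apply: (open_comp _ oU') => z _; exact: cinv.
  exists (U `&` [set z | U' z^-g]), (V `&` V'); split.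
  + by split; [exact: openI|exists x].
  + by split; [exact: openI|exists (x *g w); split=> //; exact: WV].
  + by move=> z [].
  + by move=> z [].
  + move=> x' y' [_ /= U'x'] [_ V'y'] [u Nu]; apply: WF => //; exact: UV'.
have /choice[g0 g0P] : forall ns : nat * seq bool, exists k,
    forall x, S ns.1 ns.2 x -> Q ns.1 ((c ns.1 k)^-g *g x).
  by move=> [n s]; have [_] := SP n s.
pose g s := g0 (size s, s).
have gS a x : (forall n, S n (mkseq a n) x) -> in_branch g a x.
  move=> Sx n; have := g0P (size (mkseq a n), mkseq a n) x.
  by rewrite /g /= size_mkseq; apply.
exists g; first split.
- by move=> a; have [x Sx] := Sa a; exists x; exact: gS.
- move=> a b x y u j ab gx gy Nu Fxy.
  have [x' Sx'] := Sa a; have [y' Sy'] := Sa b.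
  have [n ne] : exists n, a n <> b n.
    apply: contrapT => /forallNP neq; apply/ab/funext => n.
    by apply: contrapT; exact: neq.
  (* Prefixes of length [m] contain the index [n], so they differ, and [E j] is avoided from level
     [j] on. *)
  pose m := maxn j n.+1.
  apply: (SE m j (mkseq a m) (mkseq b m)) (Sx' m) (Sy' m) _.
  + exact: leq_maxl.
  + exact: size_mkseq.
  + exact: size_mkseq.
  + move=> /(congr1 (nth false ^~ n)) /=.
    by rewrite !nth_mkseq ?leq_maxr.
  have Nx := in_branch_coset gx (gS _ _ Sx'); have Ny := in_branch_coset gy (gS _ _ Sy').
  (* Replacing [x], [y] by [x'], [y'] leaves corrections in [N]; conjugation moves the first one to
     the right. *)
  exists ((y'^-g *g x') *g (x^-g *g x') *g (y'^-g *g x')^-g *g ((y^-g *g y')^-g *g u)).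
    by apply: NM; [exact: NJ|apply: NM => //; exact: NV].
  by move: Fxy; rewrite !gE.
- move=> a x gx; have [y Sy] := Sa a; exists y.
    exact: in_branch_coset (gS _ _ Sy) gx.
  split; first by have /SO := Sy 0%N.
  move=> /MK[n _ Ky]; have [/(_ _ (Sy n)) + _] := SP n (mkseq a n).
  by apply; exact: subset_closure.
Qed.

Lemma no_baire_translates (A : set X) : A e -> (forall x, A x -> A x^-g) ->
  (forall x y, A x -> A y -> exists j, F j (x *g y)) ->
  ~ forall T : set X, baire_property [set x | exists2 t, T t & A (t^-g *g x)].
Proof.
move=> A1 AV AF AT.
pose R x y := exists2 u, N u & A (x^-g *g y *g u).
have Rsym x y : R x y -> R y x.
  move=> [u Nu /AV]; rewrite !gE => Au.
  exists ((x^-g *g y) *g u^-g *g (x^-g *g y)^-g); first by apply: NJ; exact: NV.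
  by rewrite !gE.
have R_saturated x y z : R x y -> N (y^-g *g z) -> R x z.
  move=> [u Nu Au] Nyz; exists ((y^-g *g z)^-g *g u); last by move: Au; rewrite !gE.
  by apply: NM => //; exact: NV.
(* Every code receives two points: the one flagged [false] enters [T], the one flagged [true] is to
   stay outside [Z]. *)
pose I := ({g | perfect_code g} * bool)%type.
(* Indices embed into branches: bits at [Some (s, k)] record the graph of the code, the bit at
   [None] records the flag. *)
pose branch (i : I) m := match unpickle m : option (option (seq bool * nat)) with
  | Some (Some (s, k)) => sval i.1 s == k
  | _ => i.2
  end.
have branch_inj : injective branch.
  move=> [[g gP] b] [[g' gP'] b'] gg'.
  have <- : b = b'.
    by have := congr1 (fun a => a (pickle (None : option (seq bool * nat)))) gg';
      rewrite /branch pickleK.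
  congr pair; apply: eq_exist; apply/funext => s.
  have := congr1 (fun a => a (pickle (Some (s, g s)))) gg'.
  by rewrite /branch pickleK /= eqxx => /esym/eqP.
pose p (i i' : I) : X := xget e (in_branch (sval i.1) (branch i')).
have pP i i' : in_branch (sval i.1) (branch i') (p i i').
  by have [g0 _] := svalP i.1; have [x gx] := g0 (branch i'); exact: xgetI gx.
have [|z zP] := unrelated_selection (p := p) Rsym.
  move=> i x i1 i2 [u Nu /AV Au] [v Nv Av].
  (* Two points related to [x] have a quotient in [A A N], hence in some [F j N], which is forbidden
     for distinct branches. *)
  apply: contrapT => i12; have [j /subset_closure] := AF _ _ Au Av.
  have [_ /(_ (branch i1) (branch i2) (p i i1) (p i i2)
    ((p i i2)^-g *g p i i1 *g u^-g *g ((p i i2)^-g *g p i i1)^-g *g v) j)] := svalP i.1.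
  rewrite !gE; apply; [by move=> /branch_inj|exact: pP|exact: pP|].
  have := NM (NJ ((p i i2)^-g *g p i i1) (NV Nu)) Nv.
  by rewrite !gE.
pose w i := p i (z i).
pose T : set X := [set x | exists g, N ((w (g, false))^-g *g x)].
pose Z := [set x | exists2 t, T t & A (t^-g *g x)].
have ZE x : Z x <-> exists g, R (w (g, false)) x.
  split=> [[t [g Nt] At]|[g Rx]].
    exists g; apply: Rsym; exists ((w (g, false))^-g *g t)=> //.
    by have := AV _ At; rewrite !gE.
  have [u Nu Au] := Rsym _ _ Rx.
  exists (w (g, false) *g u); first by exists g; rewrite mulK.
  by have := AV _ Au; rewrite !gE.
have wP g b a : a = branch (z (g, b)) -> in_branch (sval g) a (w (g, b)).
  by move=> ->; exact: (pP (g, b)).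
have [U oU mZU] := baire_property_open (AT T).
(* If [U] is nonempty, a code inside [U] puts its [true] point into [Z] modulo [N]; otherwise [Z] is
   meager, yet a code avoiding it has its [false] point there. *)
have [U0|/nonemptyPn U0] := pselect (U !=set0).
- have [g gP gZ] := perfect_code_exists oU U0 mZU.
  have [y Ny [Uy nMy]] := gZ _ _ (wP (exist _ g gP) true _ erefl).
  have /ZE[g' Rg'] : Z y by apply: contrapT => nZy; apply: nMy; right.
  exact: zP (R_saturated _ _ _ Rg' Ny).
- have [g gP gZ] := perfect_code_exists openT (ex_intro _ e Logic.I) mZU.
  have [y Ny [_ nMy]] := gZ _ _ (wP (exist _ g gP) false _ erefl).
  apply: nMy; left; rewrite U0; split=> //; apply/ZE; exists (exist _ g gP).
  apply: (R_saturated _ (w (exist _ g gP, false))).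
    by exists e; rewrite // !gE.
  by have := NV Ny; rewrite !gE.
Qed.

End perfect_codes.

(** * Pettis' argument *)

Lemma meager_lmul a (M : set X) : meager M -> meager [set x | M (a *g x)].
Proof.
move=> [K [nK MK]]; exists (fun n => [set x | K n (a *g x)]); split; last first.
  by move=> x /= /MK[n _ Kx]; exists n.
have cK n x : closure [set y | K n (a *g y)] x -> closure (K n) (a *g x).
  by move=> cx B /nbhs_lmul /cx[y [Ky By]]; exists (a *g y).
move=> n; rewrite /nowhere_dense -subset0 => x Kx.
have : (closure (K n))° (a *g x).
  have := @nbhs_lmul a^-g (a *g x) _ _; rewrite mulK => /(_ _ Kx).
  by apply: filterS => y /cK; rewrite mulKV.
by rewrite nK.
Qed.

(** For [x] near [e] the open set of all [y] in [U] with [x^-g *g y] in [U] is nonempty. By Baire,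
    some such [y] has both [y] and [x^-g *g y] in [A]. *)
Lemma nonmeager_quotient_nbhs (small : nat -> set X -> Prop) (A : set X) :
  complete_smallness small -> baire_property A -> ~ meager A ->
  nbhs e [set x | exists a b, [/\ A a, A b & x = a *g b^-g]].
Proof.
move=> smallP /baire_property_open[U oU mAU] nmA.
have [[u Uu]|/nonemptyPn U0] := pselect (U !=set0); last first.
  by case: nmA; apply: meagerS mAU => x Ax; left; rewrite U0 setD0.
have : nbhs e [set x | U (x *g u)].
  by apply: nbhs_rmul; rewrite mul1; exact: open_nbhs_nbhs.
apply: filterS => x /= Uxu.
have [|||y [Uy Uxy] nMy] := @baire X small (U `&` [set y | U (x^-g *g y)])
    ((A `\` U `|` U `\` A) `|` [set y | (A `\` U `|` U `\` A) (x^-g *g y)])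
    smallP group_regular.
- by apply: openI => //; exact: open_lmul.
- by exists (x *g u); split; rewrite //= mulK.
- by apply: meagerU => //; exact: meager_lmul.
exists y, (x^-g *g y); split; last by rewrite !gE.
- by apply: contrapT => nAy; apply: nMy; left; right.
- by apply: contrapT => nAy; apply: nMy; right; right.
Qed.

End topological_group.

(** * Continuity of measurable homomorphisms *)

Theorem theorem1p3 (X Y : topologicalType)
    (mulX : X -> X -> X) (invX : X -> X) (eX : X)
    (mulY : Y -> Y -> Y) (invY : Y -> Y) (eY : Y) :
  is_topological_group mulX invX eX ->
  is_topological_group mulY invY eY ->
  omega_narrow mulX ->
  cech_complete X ->
  forall h : X -> Y, is_group_hom mulX mulY h -> BP_measurable h ->
  continuous h.
Proof.
move=> gX gY narrow /cech_complete_smallness[small smallP] h hM hBP.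
have [AX X1 XV _ _] := gX; have [AY Y1 YV cmulY _] := gY.
have YK a b : mulY (invY a) (mulY a b) = b by rewrite AY (YV a).1 (Y1 b).1.
have h1 : h eX = eY by rewrite -[LHS](YK (h eX)) -hM (X1 eX).1 (YV (h eX)).1.
have hV x : h (invX x) = invY (h x).
  by rewrite -[LHS](YK (h x)) -hM (XV x).2 h1 (Y1 _).2.
suff h_cont1 V : nbhs eY V -> nbhs eX (h @^-1` V).
  move=> x V Vhx; rewrite nbhs_simpl /=.
  have Vh : nbhs eY [set y | V (mulY (h x) y)].
    by apply: (nbhs_lmul gY); rewrite (Y1 _).2.
  have := h_cont1 _ Vh; rewrite -{1}(XV x).1 => /(nbhs_lmul gX).
  apply: filterS => y /=; rewrite hM hV AY (YV (h x)).2.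
  by rewrite (Y1 _).1.
move=> /(symmetric_nbhs gY)[W0 [oW0 W01 W0V W0M]].
have [mW0|nmW0] := pselect (meager (h @^-1` W0)); last first.
  apply: filterS (nonmeager_quotient_nbhs gX smallP (hBP _ oW0) nmW0).
  move=> _ [a [b [Wa Wb ->]]]; rewrite /preimage /= hM hV.
  by apply: W0M => //; exact: W0V.
have [F [nF W0F]] := mW0.
have [W [oW W1 WV WM]] := symmetric_nbhs gY (open_nbhs_nbhs (conj oW0 W01)).
have [Q [c Qc]] := separating_sequence_exists gX narrow smallP nF.
exfalso; apply: (no_baire_translates gX smallP Qc (A := h @^-1` W)).
- by rewrite /preimage /= h1.
- by move=> x Wx; rewrite /preimage /= hV; exact: WV.
- move=> x y Wx Wy; have [|j _ Fxy] := W0F (mulX x y); last by exists j.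
  by rewrite /preimage /= hM; exact: WM.
(* For arbitrary [T] this set is the preimage of a union of translates of [W], which is open. *)
move=> T; suff -> : [set x | exists2 t, T t & (h @^-1` W) (mulX (invX t) x)] =
    h @^-1` (\bigcup_(t in T) [set y | W (mulY (invY (h t)) y)]).
  by apply: hBP; apply: bigcup_open => t _; exact: (open_lmul gY).
apply/seteqP; split=> x [t Tt Wt]; exists t => //.
  by move: Wt; rewrite /preimage /= hM hV.
by rewrite /preimage /= hM hV.
Qed.
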